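(* The only solutions of the Vortex Filament Equation that lie in a translating plane are the line and the circle, with the latter traveling in the binormal direction. That is: let $\gamma:\mathbb{R}\times[0,\infty)\to\mathbb{R}^3$ be a smooth solution of $\partial_t\gamma=\partial_s\gamma\times\partial_{ss}\gamma$, where $s\mapsto\gamma(s,t)$ is parametrized by arclength for every $t$, and suppose that $\gamma$ lies in a translating plane. Then either for every $t$ the curve $\gamma(\cdot,t)$ is a straight line, or for every $t$ the curve $\gamma(\cdot,t)$ is a circle, and in the latter case the circle moves by translation in the direction of its binormal vector.
   Context: The Vortex Filament Equation is $\partial_t\gamma=\partial_s\gamma\times\partial_{ss}\gamma$, with $s$ arclength; where the curvature $\kappa$ is nonzero the right-hand side equals $\kappa B$, with $B$ the binormal vector. A solution $\gamma$ ''lies in a translating plane'' if there are a fixed plane $P\subset\mathbb{R}^3$ and a function $c:[0,\infty)\to\mathbb{R}^3$ such that $\gamma(s,t)\in P+c(t)$ for all $s$ and all $t\geq 0$. *)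

(* Defs.v *)
From Stdlib Require Import Reals.
From Coquelicot Require Import Coquelicot.

Open Scope R_scope.

(* A notation rather than a constant, so that the normed-module structure of
   products is inferred for R3. *)
Notation R3 := (R * R * R)%type.

Definition c1 (u : R3) : R := fst (fst u).
Definition c2 (u : R3) : R := snd (fst u).
Definition c3 (u : R3) : R := snd u.

Definition dot (u v : R3) : R := c1 u * c1 v + c2 u * c2 v + c3 u * c3 v.

Definition enorm (u : R3) : R := sqrt (dot u u).

Definition cross (u v : R3) : R3 :=
  (c2 u * c3 v - c3 u * c2 v,
   c3 u * c1 v - c1 u * c3 v,
   c1 u * c2 v - c2 u * c1 v).

(* Meaningful when the three components are differentiable, as [Derive] is
   total. *)
Definition D3 (f : R -> R3) (x : R) : R3 :=
  (Derive (fun y => c1 (f y)) x,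
   Derive (fun y => c2 (f y)) x,
   Derive (fun y => c3 (f y)) x).

(* [l] is the derivative of [f] at [x] relative to the domain [D]: at an
   endpoint of an interval this is the one-sided derivative. *)
Definition is_derive_in (D : R -> Prop) (f : R -> R3) (x : R) (l : R3) : Prop :=
  filterdiff f (within D (locally x)) (fun h : R => scal h l).

(* C^infinity on an arbitrary subset [D] of the plane: near each point of [D],
   [f] agrees on [D] with a function that is C^infinity on an open set.
   [ex_diff_n F n], required at all points of a neighbourhood, says that [F] is
   of class C^n there. *)
Definition smooth_on (D : R -> R -> Prop) (f : R -> R -> R) : Prop :=
  forall x y, D x y ->
  exists F : R -> R -> R,
    locally_2d (fun u v => (forall n : nat, ex_diff_n F n u v) /\
                           (D u v -> F u v = f u v)) x y.

Definition smooth_on3 (D : R -> R -> Prop) (f : R -> R -> R3) : Prop :=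
  smooth_on D (fun x y => c1 (f x y)) /\
  smooth_on D (fun x y => c2 (f x y)) /\
  smooth_on D (fun x y => c3 (f x y)).

(* An evolving curve is a map [gamma s t]; only its values at times [0 <= t]
   are ever used. *)
Definition slice (gamma : R -> R -> R3) (t : R) : R -> R3 :=
  fun s => gamma s t.

Definition arclength_parametrized (f : R -> R3) : Prop :=
  forall s, enorm (D3 f s) = 1.

Definition smooth_VFE_solution (gamma : R -> R -> R3) : Prop :=
  smooth_on3 (fun _ t => 0 <= t) gamma /\
  (forall t, 0 <= t -> arclength_parametrized (slice gamma t)) /\
  (forall s t, 0 <= t ->
     is_derive_in (fun t' => 0 <= t') (gamma s) t
       (cross (D3 (slice gamma t) s) (D3 (D3 (slice gamma t)) s))).

Definition is_plane (P : R3 -> Prop) : Prop :=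
  exists p n : R3, n <> zero /\ forall x, P x <-> dot (minus x p) n = 0.

(* [gamma s t] lies in P + c(t) exactly when [gamma s t - c t] lies in P. *)
Definition lies_in_translating_plane (gamma : R -> R -> R3) : Prop :=
  exists (P : R3 -> Prop) (c : R -> R3),
    is_plane P /\ forall s t, 0 <= t -> P (minus (gamma s t) (c t)).

Definition image (f : R -> R3) (x : R3) : Prop := exists s, x = f s.

Definition is_line (A : R3 -> Prop) : Prop :=
  exists p v : R3, v <> zero /\
    forall x, A x <-> exists a : R, x = plus p (scal a v).

Definition is_circle (A : R3 -> Prop) : Prop :=
  exists (p n : R3) (r : R), n <> zero /\ 0 < r /\
    forall x, A x <-> dot (minus x p) n = 0 /\ enorm (minus x p) = r.

(* The Frenet data below are those of an arclength-parametrized curve; normal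
   and binormal are meaningful where the curvature is nonzero. *)
Definition tangent (f : R -> R3) : R -> R3 := D3 f.
Definition curvature (f : R -> R3) (s : R) : R := enorm (D3 (tangent f) s).
Definition normal (f : R -> R3) (s : R) : R3 :=
  scal (/ curvature f s) (D3 (tangent f) s).
Definition binormal (f : R -> R3) (s : R) : R3 :=
  cross (tangent f s) (normal f s).

(* The curve is rigidly translated, its binormal is a constant vector [b], and
   the displacement is along [b], strictly increasing in time: it does move,
   and towards [+ b]. *)
Definition translates_along_binormal (gamma : R -> R -> R3) : Prop :=
  exists (b : R3) (d : R -> R),
    (forall t1 t2, 0 <= t1 -> t1 < t2 -> d t1 < d t2) /\
    forall s t, 0 <= t ->
      curvature (slice gamma t) s <> 0 /\
      binormal (slice gamma t) s = b /\
      gamma s t = plus (gamma s 0) (scal (d t) b).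

(* Main.v *)
From Stdlib Require Import Reals Lra.
From Coquelicot Require Import Coquelicot.
Require Import Defs.
Open Scope R_scope.

(** Let [n] be a unit normal of the plane, [T] the tangent and [k] the signed
    curvature of a slice, so that [T' = k (n x T)]: indeed [T] is orthogonal to
    [n] because [gamma . n] does not depend on [s], hence so is [T'], and [T']
    is orthogonal to the unit vector [T]; only the direction [n x T] remains
    ([planar_acceleration]). The equation then reads

      d gamma / dt = T x T' = k n,

    so every point moves along the fixed direction [n]
    ([one_sided_motion_along]). The height [gamma . n] being the same for all
    [s], the whole curve is translated; therefore [T], [T'] and [k] do not
    depend on [t]. Each point thus moves with the constant velocity
    [k(s) n], and once more the equality of heights, now compared at time 1
    and at time 0, shows that [k(s)] does not depend on [s]
    ([VFE_in_translating_plane]). No mixed derivative of [gamma] is exchanged: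
    the independence of time of [T] comes from the translation itself.

    It remains to recognize plane curves of constant signed curvature [k]. If
    [k = 0], then [T' = 0] and the curve is a line. Otherwise
    [f + (1/k) (n x T)] has zero derivative, so [f] stays on a circle, and
    [T] solves the linear equation [T' = k (n x T)], hence rotates uniformly
    and takes every direction of the plane, so that the whole circle is
    described ([tangent_rotates], [curved_image_is_circle]). Finally, the
    binormal is [(k / |k|) n], and the displacement [k t n] is [|k| t] times
    that vector. *)

(** * Vector algebra in space *)

Lemma vec_ext (u v : R3) : c1 u = c1 v -> c2 u = c2 v -> c3 u = c3 v -> u = v.
Proof.
  destruct u as [[u1 u2] u3], v as [[v1 v2] v3]; unfold c1, c2, c3; simpl.
  now intros -> -> ->.
Qed.

Ltac vec_unfold :=
  repeat (progress (unfold enorm, dot, cross, c1, c2, c3, minus, plus, opp,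
                      scal, mult, zero, one); simpl).

(* Proves identities that are polynomial in the components. *)
Ltac vec_ring :=
  repeat match goal with u : R3 |- _ => destruct u as [[? ?] ?] end;
  try apply vec_ext; vec_unfold; ring.

Lemma dot_sym (u v : R3) : dot u v = dot v u.
Proof. vec_ring. Qed.

Lemma dot_minus_l (u v w : R3) : dot (minus u v) w = dot u w - dot v w.
Proof. vec_ring. Qed.

Lemma dot_plus_l (u v w : R3) : dot (plus u v) w = dot u w + dot v w.
Proof. vec_ring. Qed.

Lemma dot_scal_l (a : R) (u w : R3) : dot (scal a u) w = a * dot u w.
Proof. vec_ring. Qed.

Lemma cross_scal_r (a : R) (u v : R3) : cross u (scal a v) = scal a (cross u v).
Proof. vec_ring. Qed.

Lemma cross_cross_self (u v : R3) :
  cross u (cross u v) = minus (scal (dot u v) u) (scal (dot u u) v).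
Proof. vec_ring. Qed.

Lemma dot_self_pos (u : R3) : 0 <= dot u u.
Proof. unfold dot. nra. Qed.

Lemma dot_self_0 (u : R3) : dot u u = 0 -> u = zero.
Proof.
  intros H. unfold dot in H.
  apply vec_ext;
    [change (c1 u = 0) | change (c2 u = 0) | change (c3 u = 0)]; nra.
Qed.

Lemma cross_cross_orthonormal (n u : R3) :
  dot n n = 1 -> dot u n = 0 -> cross n (cross n u) = opp u.
Proof.
  intros Hn Hu. rewrite cross_cross_self, Hn, dot_sym, Hu. vec_ring.
Qed.

Lemma dot_cross_self (n u : R3) :
  dot (cross n u) (cross n u) = dot n n * dot u u - dot u n * dot u n.
Proof. vec_ring. Qed.

(** The vector [v] is a multiple of [m = n x u], since [v x (n x u)] expands
    into multiples of [v . u] and [v . n], and a vector whose cross product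
    with the unit vector [m] vanishes equals its projection on [m]. *)
Lemma orthogonal_to_frame (n u v : R3) :
  dot n n = 1 -> dot u u = 1 -> dot u n = 0 -> dot v n = 0 -> dot v u = 0 ->
  v = scal (dot v (cross n u)) (cross n u).
Proof.
  intros Hn Hu Hun Hvn Hvu.
  assert (M : dot (cross n u) (cross n u) = 1)
    by (rewrite dot_cross_self, Hn, Hu, Hun; ring).
  assert (Z : cross v (cross n u) = zero).
  { transitivity (minus (scal (dot v u) n) (scal (dot v n) u)); [vec_ring |].
    rewrite Hvu, Hvn. vec_ring. }
  set (m := cross n u) in *.
  transitivity (plus (cross m (cross v m)) (scal (dot v m) m)).
  - transitivity (scal (dot m m) v); [rewrite M |]; vec_ring.
  - rewrite Z. vec_ring.
Qed.

Lemma plane_expansion (n u w : R3) :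
  dot n n = 1 -> dot u u = 1 -> dot u n = 0 -> dot w n = 0 ->
  w = plus (scal (dot w u) u) (scal (dot w (cross n u)) (cross n u)).
Proof.
  intros Hn Hu Hun Hwn.
  assert (E := orthogonal_to_frame n u (minus w (scal (dot w u) u)) Hn Hu Hun).
  rewrite !dot_minus_l, !dot_scal_l, Hu, Hun, Hwn in E.
  replace (dot u (cross n u)) with 0 in E by vec_ring.
  rewrite !Rmult_0_r, !Rminus_0_r in E.
  rewrite <- E by ring. vec_ring.
Qed.

Lemma enorm_eq (u : R3) (r : R) : 0 < r -> enorm u = r <-> dot u u = r * r.
Proof.
  intros Hr. unfold enorm. split; intros H.
  - rewrite <- H. symmetry. apply sqrt_sqrt, dot_self_pos.
  - rewrite H. apply sqrt_square. lra.
Qed.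

Lemma plane_unit_normal (P : R3 -> Prop) :
  is_plane P ->
  exists (n : R3) (a : R), dot n n = 1 /\ forall x, P x -> dot x n = a.
Proof.
  intros (p & n & Hn & HP).
  assert (Hpos : 0 < dot n n).
  { destruct (dot_self_pos n) as [H | H]; [exact H |].
    now destruct Hn; apply dot_self_0. }
  assert (Hs : 0 < sqrt (dot n n)) by now apply sqrt_lt_R0.
  exists (scal (/ sqrt (dot n n)) n), (/ sqrt (dot n n) * dot p n). split.
  - transitivity (/ sqrt (dot n n) * / sqrt (dot n n) * dot n n); [vec_ring |].
    pose proof (sqrt_sqrt (dot n n) (Rlt_le _ _ Hpos)) as Hq.
    set (q := sqrt (dot n n)) in *. rewrite <- Hq. field. lra.
  - intros x Hx. apply HP in Hx. rewrite dot_minus_l in Hx.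
    rewrite dot_sym, dot_scal_l, (dot_sym n x). f_equal. lra.
Qed.

Lemma unit_circle_angle (a b : R) :
  a * a + b * b = 1 -> exists x, cos x = a /\ sin x = b.
Proof.
  intros H.
  assert (Ha : -1 <= a <= 1) by nra.
  assert (S : forall c, 0 <= c -> a * a + c * c = 1 -> sin (acos a) = c).
  { intros c Hc Hac. rewrite sin_acos by exact Ha.
    replace (1 - a²) with (c * c) by (unfold Rsqr; lra). now apply sqrt_square. }
  destruct (Rle_dec 0 b) as [Hb | Hb].
  - exists (acos a). split; [now apply cos_acos | now apply S].
  - exists (- acos a). rewrite cos_neg, sin_neg. split; [now apply cos_acos |].
    rewrite (S (- b)); lra.
Qed.

(** * Differentiation of curves in space *)

(** Composing [f] with the clamping [t |-> max 0 t] produces a function with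
    zero two-sided derivative on the whole line, because clamping does not
    increase distances. This reduces the boundary point 0 to the interior
    case. *)
Lemma constant_of_zero_one_sided_derivative {V : NormedModule R_AbsRing}
  (f : R -> V) :
  (forall t, 0 <= t ->
     filterdiff f (within (fun t' => 0 <= t') (locally t))
       (fun h : R => scal h zero)) ->
  forall t, 0 <= t -> f t = f 0.
Proof.
  intros H t Ht.
  destruct (Req_dec t 0) as [-> | Hne]; [reflexivity |].
  assert (E : f (Rmax 0 0) = f (Rmax 0 t)).
  { apply (eq_is_derive (fun x => f (Rmax 0 x))); [| lra].
    intros x _. split; [apply is_linear_scal_l |].
    intros y Hy eps.
    rewrite <- (is_filter_lim_locally_unique (V := R_NormedModule) x y Hy).
    clear y Hy.
    destruct (H (Rmax 0 x) (Rmax_l 0 x)) as [_ Hx].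
    assert (L : is_filter_lim (within (fun t' => 0 <= t') (locally (Rmax 0 x)))
                  (Rmax 0 x)).
    { intros P [d Hd]. exists d. intros z Hz _. now apply Hd. }
    destruct (Hx (Rmax 0 x) L eps) as [d Hd].
    assert (K : forall y, Rabs (Rmax 0 y - Rmax 0 x) <= Rabs (y - x)).
    { intros y. unfold Rmax.
      destruct (Rle_dec 0 y), (Rle_dec 0 x); unfold Rabs;
        repeat destruct Rcase_abs; lra. }
    exists d. intros y Hy.
    change (Rabs (y - x) < d) in Hy.
    pose proof (K y) as Ky.
    assert (B : ball (Rmax 0 x) d (Rmax 0 y)).
    { change (Rabs (Rmax 0 y - Rmax 0 x) < d). lra. }
    specialize (Hd _ B (Rmax_l 0 y)). cbv beta in Hd |- *.
    rewrite scal_zero_r in Hd.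
    change (norm (minus (minus (f (Rmax 0 y)) (f (Rmax 0 x)))
                    (scal (y - x) (zero : V))) <= eps * Rabs (y - x)).
    assert (Z : scal (y - x) (zero : V) = zero)
      by exact (scal_zero_r (V := V) (y - x)).
    rewrite Z.
    eapply Rle_trans; [exact Hd |].
    apply Rmult_le_compat_l; [left; apply cond_pos | exact Ky]. }
  rewrite (Rmax_left 0 0), (Rmax_right 0 t) in E by lra. now symmetry.
Qed.

Lemma affine_of_constant_one_sided_derivative (f : R -> R3) (l : R3) :
  (forall t, 0 <= t ->
     filterdiff f (within (fun t' => 0 <= t') (locally t))
       (fun h : R => scal h l)) ->
  forall t, 0 <= t -> f t = plus (f 0) (scal t l).
Proof.
  intros H t Ht.
  assert (E : minus (f t) (scal t l) = minus (f 0) (scal 0 l)).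
  { apply (constant_of_zero_one_sided_derivative
             (fun x => minus (f x) (scal x l))); [| easy].
    intros x Hx.
    eapply filterdiff_ext_lin.
    - apply (filterdiff_minus_fct (U := R_NormedModule) f (fun h : R => scal h l));
        [now apply H |].
      apply filterdiff_linear, (is_linear_scal_l l).
    - intros h. cbv beta. rewrite minus_eq_zero. symmetry.
      exact (scal_zero_r h). }
  transitivity (plus (minus (f t) (scal t l)) (scal t l)); [| rewrite E];
    vec_ring.
Qed.

Lemma is_linear_dot (e : R3) : is_linear (fun u : R3 => dot u e).
Proof.
  assert (C : forall m n : R_AbsRing, mult m n = mult n m)
    by (intros; apply Rmult_comm).
  apply is_linear_ext with
    (fun u : R3 => plus (plus (scal (c1 e) (fst (fst u)))
                              (scal (c2 e) (snd (fst u))))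
                        (scal (c3 e) (snd u))).
  { intros u. vec_ring. }
  assert (S : forall l1 l2 : R3 -> R, is_linear l1 -> is_linear l2 ->
     is_linear (fun u => plus (l1 u) (l2 u))).
  { intros l1 l2 H1 H2.
    exact (is_linear_comp _ _ (is_linear_prod _ _ H1 H2) is_linear_plus). }
  assert (M : forall (k : R) (l : R3 -> R), is_linear l ->
     is_linear (fun u => scal k (l u))).
  { intros k l Hl.
    exact (is_linear_comp _ _ Hl (is_linear_scal_r k C)). }
  repeat apply S; apply M.
  - exact (is_linear_comp _ _ is_linear_fst is_linear_fst).
  - exact (is_linear_comp _ _ is_linear_fst is_linear_snd).
  - exact is_linear_snd.
Qed.

Lemma is_linear_cross (n : R3) : is_linear (cross n).
Proof.
  apply is_linear_ext with
    (fun u : R3 => (dot u (0, - c3 n, c2 n),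
                    dot u (c3 n, 0, - c1 n),
                    dot u (- c2 n, c1 n, 0))).
  { intros u. vec_ring. }
  repeat apply is_linear_prod; apply is_linear_dot.
Qed.

(** The line through [(s, t)] along which [f] is differentiated stays inside
    [D], so near [s] the slice of [f] is that of the smooth extension; this
    covers the boundary time as well. *)
Lemma smooth_on_slice (D : R -> R -> Prop) (f : R -> R -> R) (s t : R) :
  smooth_on D f -> (forall x, D x t) ->
  ex_derive (fun x => f x t) s /\ ex_derive (Derive (fun x => f x t)) s.
Proof.
  intros Hf HD.
  destruct (Hf s t (HD s)) as [F HF].
  assert (Feq : locally s (fun x => F x t = f x t)).
  { generalize (locally_2d_1d_const_y _ _ _ HF). apply filter_imp.
    intros x [_ E]. now apply E. }
  destruct (locally_2d_singleton _ _ _ HF) as [Fsm _].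
  destruct (Fsm 2%nat) as (_ & F1 & _ & (_ & F2 & _) & _).
  split.
  - now apply ex_derive_ext_loc with (fun x => F x t).
  - apply ex_derive_ext_loc with (Derive (fun x => F x t)); [| exact F2].
    apply locally_locally in Feq. revert Feq. apply filter_imp.
    intros x Hx. now apply Derive_ext_loc.
Qed.

Lemma is_derive_comp_linear {V : NormedModule R_AbsRing} (L : R3 -> V)
  (f : R -> R3) (x : R) (l : R3) :
  is_linear L -> is_derive f x l -> is_derive (fun s => L (f s)) x (L l).
Proof.
  intros HL Hf.
  eapply filterdiff_ext_lin.
  - apply (filterdiff_comp f L _ L Hf), filterdiff_linear, HL.
  - intros h. exact (linear_scal L HL h l).
Qed.

Lemma is_linear_components :
  is_linear (fun u : R3 => c1 u) /\ is_linear (fun u : R3 => c2 u) /\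
  is_linear (fun u : R3 => c3 u).
Proof.
  refine (conj _ (conj _ _)).
  - exact (is_linear_comp _ _ is_linear_fst is_linear_fst).
  - exact (is_linear_comp _ _ is_linear_fst is_linear_snd).
  - exact is_linear_snd.
Qed.

Lemma D3_unique (f : R -> R3) (x : R) (l : R3) : is_derive f x l -> D3 f x = l.
Proof.
  intros Hf. destruct is_linear_components as (L1 & L2 & L3).
  apply vec_ext; apply is_derive_unique.
  - exact (is_derive_comp_linear _ _ _ _ L1 Hf).
  - exact (is_derive_comp_linear _ _ _ _ L2 Hf).
  - exact (is_derive_comp_linear _ _ _ _ L3 Hf).
Qed.

Lemma is_derive_D3 (f : R -> R3) (x : R) :
  ex_derive (fun s => c1 (f s)) x -> ex_derive (fun s => c2 (f s)) x ->
  ex_derive (fun s => c3 (f s)) x -> is_derive f x (D3 f x).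
Proof.
  intros H1 H2 H3.
  assert (S : forall (g : R -> R) (e : R3), ex_derive g x ->
    is_derive (fun s => scal (g s) e) x (scal (Derive g x) e)).
  { intros g e Hg.
    exact (is_derive_scal_l g x (Derive g x) e (Derive_correct _ _ Hg)). }
  assert (A : forall (F G : R -> R3) (dF dG : R3), is_derive F x dF ->
    is_derive G x dG -> is_derive (fun s => plus (F s) (G s)) x (plus dF dG)).
  { intros F G dF dG HF HG. exact (is_derive_plus F G x dF dG HF HG). }
  pose proof (A _ _ _ _ (A _ _ _ _ (S _ (1, 0, 0) H1) (S _ (0, 1, 0) H2))
                (S _ (0, 0, 1) H3)) as H.
  eapply is_derive_ext; [| evar_last; [exact H |]].
  - intros s. vec_ring.
  - vec_ring.
Qed.

Lemma is_derive_dot (f g : R -> R3) (x : R) (df dg : R3) :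
  is_derive f x df -> is_derive g x dg ->
  is_derive (fun s => dot (f s) (g s)) x (dot df (g x) + dot (f x) dg).
Proof.
  intros Hf Hg. destruct is_linear_components as (L1 & L2 & L3).
  pose proof (is_derive_comp_linear _ _ _ _ L1 Hf) as F1.
  pose proof (is_derive_comp_linear _ _ _ _ L2 Hf) as F2.
  pose proof (is_derive_comp_linear _ _ _ _ L3 Hf) as F3.
  pose proof (is_derive_comp_linear _ _ _ _ L1 Hg) as G1.
  pose proof (is_derive_comp_linear _ _ _ _ L2 Hg) as G2.
  pose proof (is_derive_comp_linear _ _ _ _ L3 Hg) as G3.
  pose proof (is_derive_plus _ _ _ _ _
    (is_derive_plus _ _ _ _ _ (Derive.is_derive_mult _ _ _ _ _ F1 G1)
       (Derive.is_derive_mult _ _ _ _ _ F2 G2))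
    (Derive.is_derive_mult _ _ _ _ _ F3 G3)) as H.
  replace (dot df (g x) + dot (f x) dg) with
    (plus (plus (c1 df * c1 (g x) + c1 (f x) * c1 dg)
                (c2 df * c2 (g x) + c2 (f x) * c2 dg))
          (c3 df * c3 (g x) + c3 (f x) * c3 dg)) by vec_ring.
  exact H.
Qed.

Lemma constant_of_zero_derivative {V : NormedModule R_AbsRing} (f : R -> V) :
  (forall s, is_derive f s zero) -> forall s, f s = f 0.
Proof.
  intros H s. destruct (Rtotal_order s 0) as [h | [-> | h]].
  - apply eq_is_derive; auto.
  - reflexivity.
  - symmetry. apply eq_is_derive; auto.
Qed.

(** * Plane curves of constant curvature *)

(** The Frenet equations, with signed curvature [k] and tangent [T], in the
    plane of unit normal [n] oriented so that the normal vector is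
    [n x T]. *)
Record planar_unit_speed (n : R3) (k : R) (f T : R -> R3) : Prop := {
  unit_normal : dot n n = 1;
  velocity s : is_derive f s (T s);
  turning s : is_derive T s (scal k (cross n (T s)));
  unit_speed s : dot (T s) (T s) = 1;
  planar s : dot (T s) n = 0
}.

(** The vector [n x D] is orthogonal to [D], so the flow preserves the norm. *)
Lemma rotation_ode_unique (n : R3) (k : R) (D : R -> R3) :
  (forall s, is_derive D s (scal k (cross n (D s)))) -> D 0 = zero ->
  forall s, D s = zero.
Proof.
  intros HD H0 s. apply dot_self_0.
  transitivity (dot (D 0) (D 0)); [| rewrite H0; vec_ring].
  apply (constant_of_zero_derivative (fun s => dot (D s) (D s))).
  intros x. evar_last; [apply is_derive_dot; apply HD |].
  vec_ring.
Qed.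

(** Both sides solve [X' = k (n x X)] with the same value at 0; for the
    right-hand side this uses [n x (n x T 0) = - T 0]. *)
Lemma tangent_rotates (n : R3) (k : R) (f T : R -> R3) :
  planar_unit_speed n k f T -> forall s,
  T s = plus (scal (cos (k * s)) (T 0)) (scal (sin (k * s)) (cross n (T 0))).
Proof.
  intros [Hn _ HT _ Hp].
  pose (E := fun s => plus (scal (cos (k * s)) (T 0))
                           (scal (sin (k * s)) (cross n (T 0)))).
  assert (HE : forall s, is_derive E s (scal k (cross n (E s)))).
  { intros s.
    assert (Hc : is_derive (fun s => cos (k * s)) s (- k * sin (k * s)))
      by (auto_derive; [easy | ring]).
    assert (Hs : is_derive (fun s => sin (k * s)) s (k * cos (k * s)))
      by (auto_derive; [easy | ring]).
    pose proof (is_derive_plus _ _ _ _ _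
      (is_derive_scal_l _ _ _ (T 0) Hc)
      (is_derive_scal_l _ _ _ (cross n (T 0)) Hs)) as H.
    evar_last; [exact H |].
    transitivity (scal k (plus (scal (cos (k * s)) (cross n (T 0)))
      (scal (sin (k * s)) (cross n (cross n (T 0)))))).
    - rewrite (cross_cross_orthonormal n (T 0) Hn (Hp 0)). vec_ring.
    - unfold E. vec_ring. }
  assert (D : forall s, minus (T s) (E s) = zero).
  { apply (rotation_ode_unique n k (fun s => minus (T s) (E s))).
    - intros s.
      pose proof (is_derive_minus _ _ _ _ _ (HT s) (HE s)) as H.
      evar_last; [exact H |]. vec_ring.
    - unfold E. rewrite Rmult_0_r, cos_0, sin_0. vec_ring. }
  intros s. change (T s = E s).
  transitivity (plus (minus (T s) (E s)) (E s)); [| rewrite D]; vec_ring.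
Qed.

(** The centre of curvature [f + (1/k) (n x T)] has derivative
    [T + n x (n x T) = 0]. *)
Lemma curve_on_circle (n : R3) (k : R) (f T : R -> R3) :
  k <> 0 -> planar_unit_speed n k f T -> exists p : R3,
  forall s, minus (f s) p = opp (scal (/ k) (cross n (T s))).
Proof.
  intros Hk [Hn Hf HT _ Hp].
  exists (plus (f 0) (scal (/ k) (cross n (T 0)))). intros s.
  assert (E : plus (f s) (scal (/ k) (cross n (T s))) =
              plus (f 0) (scal (/ k) (cross n (T 0)))).
  { apply (constant_of_zero_derivative
             (fun s => plus (f s) (scal (/ k) (cross n (T s))))).
    intros x.
    pose proof (is_derive_comp_linear _ _ _ _
      (is_linear_comp _ _ (is_linear_cross n)
         (is_linear_scal_r (/ k) Rmult_comm)) (HT x)) as H1.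
    pose proof (is_derive_plus _ _ _ _ _ (Hf x) H1) as H.
    evar_last; [exact H |].
    rewrite cross_scal_r, (cross_cross_orthonormal n (T x) Hn (Hp x)).
    transitivity (scal (1 - / k * k) (T x)); [vec_ring |].
    rewrite Rinv_l by exact Hk. vec_ring. }
  rewrite <- E. vec_ring.
Qed.

(** A point [p + y] of the circle is reached at the parameter where the tangent is
    [w = k (n x y)], and such a parameter exists since the tangent takes every unit
    value orthogonal to [n]. *)
Lemma curved_image_is_circle (n : R3) (k : R) (f T : R -> R3) :
  k <> 0 -> planar_unit_speed n k f T -> is_circle (image f).
Proof.
  intros Hk Hpl.
  destruct (curve_on_circle n k f T Hk Hpl) as [p Hc].
  pose proof (tangent_rotates n k f T Hpl) as Hrot.
  destruct Hpl as [Hn _ _ Hu Hp].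
  assert (Hr : 0 < / Rabs k) by now apply Rinv_0_lt_compat, Rabs_pos_lt.
  assert (Hrr : / Rabs k * / Rabs k = / k * / k).
  { rewrite <- Rabs_inv. unfold Rabs. destruct Rcase_abs; ring. }
  exists p, n, (/ Rabs k). split; [| split; [exact Hr |]].
  { intros H0. rewrite H0 in Hn. revert Hn. vec_unfold. lra. }
  intros x. split.
  - intros [s ->]. rewrite (enorm_eq _ _ Hr), Hrr, Hc. split; [vec_ring |].
    transitivity (/ k * / k * dot (cross n (T s)) (cross n (T s)));
      [vec_ring |].
    rewrite dot_cross_self, Hn, Hu, Hp. ring.
  - intros [Hxn Hxr]. rewrite (enorm_eq _ _ Hr), Hrr in Hxr.
    set (y := minus x p) in *.
    set (w := scal k (cross n y)).
    assert (Hw : dot w w = 1).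
    { transitivity (k * k * dot (cross n y) (cross n y)); [unfold w; vec_ring |].
      rewrite dot_cross_self, Hn, Hxr, Hxn. now field. }
    assert (Hwn : dot w n = 0) by (unfold w; vec_ring).
    pose proof (plane_expansion n (T 0) w Hn (Hu 0) (Hp 0) Hwn) as Ew.
    destruct (unit_circle_angle (dot w (T 0)) (dot w (cross n (T 0))))
      as [th [Hcos Hsin]].
    { pose proof (f_equal (fun v => dot v w) Ew) as H. cbv beta in H.
      rewrite dot_plus_l, !dot_scal_l, Hw, (dot_sym (T 0) w),
        (dot_sym (cross n (T 0)) w) in H.
      now symmetry. }
    exists (th / k).
    assert (ET : T (th / k) = w).
    { rewrite Hrot. replace (k * (th / k)) with th by now field.
      now rewrite Hcos, Hsin. }
    assert (Ey : minus (f (th / k)) p = y).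
    { rewrite Hc, ET. unfold w.
      rewrite cross_scal_r, (cross_cross_orthonormal n y Hn Hxn).
      transitivity (scal (/ k * k) y); [vec_ring |].
      rewrite Rinv_l by exact Hk. vec_ring. }
    transitivity (plus y p); [unfold y; vec_ring |].
    rewrite <- Ey. vec_ring.
Qed.

Lemma uncurved_image_is_line (n : R3) (f T : R -> R3) :
  planar_unit_speed n 0 f T -> is_line (image f).
Proof.
  intros [Hn Hf HT Hu Hp].
  assert (ET : forall s, T s = T 0).
  { apply constant_of_zero_derivative. intros s.
    evar_last; [apply HT |]. vec_ring. }
  assert (Ef : forall s, minus (f s) (scal s (T 0)) = f 0).
  { intros s. transitivity (minus (f 0) (scal 0 (T 0))); [| vec_ring].
    apply (constant_of_zero_derivative (fun s => minus (f s) (scal s (T 0)))).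
    intros x.
    pose proof (is_derive_minus _ _ _ _ _ (Hf x)
      (is_derive_scal_l _ _ _ (T 0) (is_derive_id x))) as H.
    evar_last; [exact H |]. rewrite ET. vec_ring. }
  exists (f 0), (T 0). split.
  - intros H0. specialize (Hu 0). rewrite H0 in Hu. revert Hu. vec_unfold. lra.
  - assert (Es : forall s, f s = plus (f 0) (scal s (T 0))).
    { intros s. rewrite <- (Ef s). vec_ring. }
    intros x. split; intros [s ->]; exists s; [| symmetry]; apply Es.
Qed.

Lemma curvature_of_planar (n : R3) (k : R) (f : R -> R3) :
  planar_unit_speed n k f (D3 f) -> forall s,
  curvature f s = Rabs k.
Proof.
  intros [Hn _ HT Hu Hp] s.
  unfold curvature, tangent. rewrite (D3_unique _ _ _ (HT s)). unfold enorm.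
  replace (dot (scal k (cross n (D3 f s))) (scal k (cross n (D3 f s))))
    with (k²).
  - apply sqrt_Rsqr_abs.
  - transitivity (k * k * dot (cross n (D3 f s)) (cross n (D3 f s)));
      [| vec_ring].
    rewrite dot_cross_self, Hn, Hu, Hp. unfold Rsqr. ring.
Qed.

Lemma binormal_of_planar (n : R3) (k : R) (f : R -> R3) :
  planar_unit_speed n k f (D3 f) -> forall s,
  binormal f s = scal (/ Rabs k * k) n.
Proof.
  intros H s. pose proof (curvature_of_planar n k f H s) as Hc.
  destruct H as [Hn _ HT Hu Hp].
  unfold binormal, normal, tangent. rewrite Hc, (D3_unique _ _ _ (HT s)).
  transitivity (scal (/ Rabs k * k)
    (minus (scal (dot (D3 f s) (D3 f s)) n) (scal (dot (D3 f s) n) (D3 f s)))).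
  - vec_ring.
  - rewrite Hu, Hp. vec_ring.
Qed.

(** * Evolution by the vortex filament equation *)

Lemma slice_derivatives (gamma : R -> R -> R3) (t : R) :
  smooth_on3 (fun _ t => 0 <= t) gamma -> 0 <= t -> forall s,
  is_derive (slice gamma t) s (D3 (slice gamma t) s) /\
  is_derive (D3 (slice gamma t)) s (D3 (D3 (slice gamma t)) s).
Proof.
  intros (S1 & S2 & S3) Ht s.
  destruct (smooth_on_slice _ _ s t S1 (fun _ => Ht)) as [A1 B1].
  destruct (smooth_on_slice _ _ s t S2 (fun _ => Ht)) as [A2 B2].
  destruct (smooth_on_slice _ _ s t S3 (fun _ => Ht)) as [A3 B3].
  split; apply is_derive_D3; assumption.
Qed.

(** Differentiating [f . n = a] twice and [T . T = 1] once leaves [n x T] as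
    the only direction for [A]; the coefficient [A . (n x T)], the signed
    curvature, is written as [(T x A) . n], the speed at which the flow
    moves the curve along [n]. *)
Lemma planar_acceleration (n : R3) (a : R) (f T A : R -> R3) :
  dot n n = 1 -> (forall s, dot (f s) n = a) ->
  (forall s, is_derive f s (T s)) -> (forall s, is_derive T s (A s)) ->
  (forall s, dot (T s) (T s) = 1) ->
  forall s, dot (T s) n = 0 /\
    A s = scal (dot (cross (T s) (A s)) n) (cross n (T s)) /\
    cross (T s) (A s) = scal (dot (cross (T s) (A s)) n) n.
Proof.
  intros Hn Hfn Hf HT Hu.
  assert (Z : forall (g : R -> R3) s l e c, is_derive g s l ->
     (forall s, dot (g s) e = c) -> dot l e = 0).
  { intros g s l e c Hg Hc.
    pose proof (is_derive_comp_linear _ _ _ _ (is_linear_dot e) Hg) as H.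
    apply is_derive_unique in H. rewrite <- H.
    rewrite (Derive_ext _ (fun _ => c)) by exact Hc. apply Derive_const. }
  assert (Tn : forall s, dot (T s) n = 0).
  { intros s. exact (Z _ _ _ _ _ (Hf s) Hfn). }
  intros s.
  assert (An : dot (A s) n = 0) by exact (Z _ _ _ _ _ (HT s) Tn).
  assert (AT : dot (A s) (T s) = 0).
  { pose proof (is_derive_unique _ _ _ (is_derive_dot _ _ _ _ _ (HT s) (HT s))) as H.
    rewrite (Derive_ext _ (fun _ => 1)) in H by exact Hu.
    rewrite Derive_const, (dot_sym (T s) (A s)) in H. lra. }
  pose proof (orthogonal_to_frame n (T s) (A s) Hn (Hu s) (Tn s) An AT) as E.
  replace (dot (A s) (cross n (T s))) with (dot (cross (T s) (A s)) n) in E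
    by vec_ring.
  refine (conj (Tn s) (conj E _)).
  rewrite E at 1. rewrite cross_scal_r. f_equal.
  transitivity (minus (scal (dot (T s) (T s)) n) (scal (dot (T s) n) (T s)));
    [vec_ring |].
  rewrite Hu, Tn. vec_ring.
Qed.

(** The components of [w] orthogonal to [n] have zero derivative, hence are
    constant. *)
Lemma one_sided_motion_along (n : R3) (w : R -> R3) (k : R -> R) :
  dot n n = 1 ->
  (forall t, 0 <= t ->
     is_derive_in (fun t' => 0 <= t') w t (scal (k t) n)) ->
  forall t, 0 <= t -> w t = plus (w 0) (scal (dot (w t) n - dot (w 0) n) n).
Proof.
  intros Hn Hw t Ht.
  assert (C : forall e, dot n e = 0 -> dot (w t) e = dot (w 0) e).
  { intros e He.
    apply (constant_of_zero_one_sided_derivative (fun t => dot (w t) e));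
      [| exact Ht].
    intros x Hx. eapply filterdiff_ext_lin.
    - apply (filterdiff_comp w (fun u => dot u e) _ (fun u => dot u e)
               (Hw x Hx)), filterdiff_linear, is_linear_dot.
    - intros h. cbv beta. transitivity (h * k x * dot n e); [vec_ring |].
      rewrite He. vec_ring. }
  set (d := minus (w t) (w 0)).
  set (e := minus d (scal (dot d n) n)).
  (* The part [e] of the displacement [d] orthogonal to [n] is also
     orthogonal to [d], hence to itself. *)
  assert (He : dot n e = 0).
  { unfold e. rewrite dot_sym, dot_minus_l, dot_scal_l, Hn. ring. }
  assert (Hde : dot d e = 0).
  { unfold d. rewrite dot_minus_l, (C e He). ring. }
  assert (E0 : e = zero).
  { apply dot_self_0. unfold e at 1.
    rewrite dot_minus_l, dot_scal_l, He, Hde. ring. }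
  rewrite <- dot_minus_l. fold d.
  transitivity (plus (w 0) (plus (scal (dot d n) n) e)); [unfold e, d; vec_ring |].
  rewrite E0. vec_ring.
Qed.

Lemma D3_translate (f g : R -> R3) (v : R3) :
  (forall s, f s = plus (g s) v) -> forall s, D3 f s = D3 g s.
Proof.
  intros H s. unfold D3.
  assert (S : forall (a b : R -> R) c,
    (forall s, a s = b s + c) -> Derive a s = Derive b s).
  { intros a b c E. unfold Derive. f_equal. apply Lim_ext. intros h.
    rewrite !E. f_equal. ring. }
  f_equal; [f_equal |]; eapply S; intros x; rewrite H; reflexivity.
Qed.

(** The common height is used twice: it makes the motion a translation, which
    freezes the tangent and the curvature in time, and it then makes the
    constant speed of each point independent of the point. *)
Lemma VFE_in_translating_plane (gamma : R -> R -> R3) :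
  smooth_VFE_solution gamma -> lies_in_translating_plane gamma ->
  exists (n : R3) (k : R),
    (forall t, 0 <= t ->
       planar_unit_speed n k (slice gamma t) (D3 (slice gamma t))) /\
    (forall s t, 0 <= t -> gamma s t = plus (gamma s 0) (scal (k * t) n)).
Proof.
  intros (Hsm & Harc & Hvfe) (P & c & HP & Hin).
  destruct (plane_unit_normal P HP) as (n & a & Hn & Ha).
  pose (k := fun s t =>
    dot (cross (D3 (slice gamma t) s) (D3 (D3 (slice gamma t)) s)) n).
  assert (Hh : forall s t, 0 <= t -> dot (gamma s t) n = a + dot (c t) n).
  { intros s t Ht. pose proof (Ha _ (Hin s t Ht)) as H.
    rewrite dot_minus_l in H. lra. }
  assert (Hu : forall t, 0 <= t -> forall s,
    dot (D3 (slice gamma t) s) (D3 (slice gamma t) s) = 1).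
  { intros t Ht s. rewrite <- (Rmult_1_r 1).
    apply enorm_eq; [lra |]. now apply Harc. }
  assert (Hg : forall t, 0 <= t -> forall s,
    dot (D3 (slice gamma t) s) n = 0 /\
    D3 (D3 (slice gamma t)) s =
      scal (k s t) (cross n (D3 (slice gamma t) s)) /\
    cross (D3 (slice gamma t) s) (D3 (D3 (slice gamma t)) s) =
      scal (k s t) n).
  { intros t Ht.
    exact (planar_acceleration n _ (slice gamma t) _ _ Hn
             (fun s => Hh s t Ht)
             (fun s => proj1 (slice_derivatives gamma t Hsm Ht s))
             (fun s => proj2 (slice_derivatives gamma t Hsm Ht s)) (Hu t Ht)). }
  (* The displacement along [n] is read off the common height of the curve,
     so it is the same for all [s]. *)
  assert (Hmove : forall s t, 0 <= t ->
    gamma s t = plus (gamma s 0) (scal (dot (c t) n - dot (c 0) n) n)).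
  { intros s t Ht.
    rewrite (one_sided_motion_along n (gamma s) (k s) Hn) at 1; [| | exact Ht].
    - rewrite !Hh by lra. f_equal. f_equal. ring.
    - intros x Hx. destruct (Hg x Hx s) as (_ & _ & <-). now apply Hvfe. }
  assert (HT : forall t, 0 <= t -> forall s,
    D3 (slice gamma t) s = D3 (slice gamma 0) s).
  { intros t Ht. apply D3_translate with (scal (dot (c t) n - dot (c 0) n) n).
    intros s. now apply Hmove. }
  assert (Hk : forall s t, 0 <= t -> k s t = k s 0).
  { intros s t Ht. unfold k. rewrite HT by exact Ht.
    rewrite (D3_translate (D3 (slice gamma t)) (D3 (slice gamma 0)) zero);
      [reflexivity |].
    intros x. rewrite HT by exact Ht. vec_ring. }
  assert (Haff : forall s t, 0 <= t ->
    gamma s t = plus (gamma s 0) (scal t (scal (k s 0) n))).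
  { intros s. apply affine_of_constant_one_sided_derivative.
    intros t Ht. rewrite <- (Hk s t Ht).
    destruct (Hg t Ht s) as (_ & _ & <-). now apply Hvfe. }
  (* The speed is the height gained in unit time, the same for all [s]. *)
  assert (Hks : forall s, k s 0 = k 0 0).
  { assert (E : forall s, k s 0 = dot (c 1) n - dot (c 0) n).
    { intros s.
      assert (E : dot (gamma s 1) n = dot (gamma s 0) n + k s 0 * dot n n).
      { rewrite (Haff s 1) by lra. vec_ring. }
      rewrite !Hh, Hn in E by lra. lra. }
    intros s. now rewrite !E. }
  exists n, (k 0 0). split.
  - intros t Ht. split.
    + exact Hn.
    + intros s. exact (proj1 (slice_derivatives gamma t Hsm Ht s)).
    + intros s. rewrite <- (Hks s), <- (Hk s t Ht).
      destruct (Hg t Ht s) as (_ & <- & _).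
      exact (proj2 (slice_derivatives gamma t Hsm Ht s)).
    + exact (Hu t Ht).
    + intros s. exact (proj1 (Hg t Ht s)).
  - intros s t Ht. rewrite (Haff s t Ht), Hks. vec_ring.
Qed.

Theorem lemma3p1p3 :
  forall gamma : R -> R -> R3,
    smooth_VFE_solution gamma ->
    lies_in_translating_plane gamma ->
    (forall t, 0 <= t -> is_line (image (slice gamma t))) \/
    ((forall t, 0 <= t -> is_circle (image (slice gamma t))) /\
     translates_along_binormal gamma).
Proof.
  intros gamma Hsol Hplane.
  destruct (VFE_in_translating_plane gamma Hsol Hplane) as (n & k & Hpl & Hmove).
  destruct (Req_dec k 0) as [-> | Hk]; [left | right; split].
  - intros t Ht. exact (uncurved_image_is_line n _ _ (Hpl t Ht)).
  - intros t Ht. exact (curved_image_is_circle n k _ _ Hk (Hpl t Ht)).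
  - pose proof (Rabs_pos_lt k Hk) as Habs.
    exists (scal (/ Rabs k * k) n), (fun t => Rabs k * t). split.
    + intros t1 t2 _ Ht. now apply Rmult_lt_compat_l.
    + intros s t Ht. rewrite (curvature_of_planar n k _ (Hpl t Ht) s). split; [lra |].
      split; [exact (binormal_of_planar n k _ (Hpl t Ht) s) |].
      rewrite (Hmove s t Ht).
      replace (k * t) with (Rabs k * t * (/ Rabs k * k)) by (field; lra).
      vec_ring.
Qed.
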